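(* Let $k\ge 2$ be an integer. (1) There exists a smallest positive integer $R(k)$ such that for all $r\ge R(k)$, the set $I_r=\{1,2,\dots,r\}$ can be $k$-decomposed into MSTD subsets, while $I_{R(k)-1}$ cannot be $k$-decomposed into MSTD subsets. (2) Moreover: (a) if $k$ is even, then $8k\le R(k)\le 10k$; (b) if $k\ge 5$ is odd, then $8k\le R(k)\le 20k-14$; (c) if $k=3$, then $24\le R(k)\le 4T+24$, where $T=\min\{\max A : A \text{ a finite nonempty set of positive integers with } |A+A|-|A-A|\ge 10|A|\}$.
   Context: For a set $A$ of integers, $A+A=\{x+y:x,y\in A\}$ and $A-A=\{x-y:x,y\in A\}$. A finite set $A$ is MSTD if $|A+A|>|A-A|$. A $k$-decomposition of a set $S$ is a partition of $S$ into $k$ nonempty, pairwise disjoint subsets whose union is $S$. *)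

(* Defs.v *)
From mathcomp Require Export all_boot all_order all_algebra finmap.

Set Implicit Arguments.
Unset Strict Implicit.
Unset Printing Implicit Defensive.

Import Order.TTheory GRing.Theory Num.Theory.
Local Open Scope fset_scope.
Local Open Scope ring_scope.

Definition sumset (A : {fset int}) : {fset int} :=
  [fset x + y | x in A, y in A].

Definition diffset (A : {fset int}) : {fset int} :=
  [fset x - y | x in A, y in A].

Definition MSTD (A : {fset int}) : bool := (#|` diffset A| < #|` sumset A|)%N.

Definition k_decomposition (k : nat) (S : {fset int})
    (P : {fset {fset int}}) : Prop :=
  [/\ #|` P| = k,
      forall A, A \in P -> A != fset0,
      forall A B, A \in P -> B \in P -> A != B -> [disjoint A & B]%fset
    & fcover P = S].

Definition initial_interval (r : nat) : {fset int} :=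
  [fset i%:Z | i in iota 1 r].

Definition MSTD_decomposable (k : nat) (S : {fset int}) : Prop :=
  exists P : {fset {fset int}},
    k_decomposition k S P /\ (forall A, A \in P -> MSTD A).

Definition is_least (P : nat -> Prop) (n : nat) : Prop :=
  P n /\ forall m, P m -> (n <= m)%N.

Definition is_max (A : {fset int}) (m : int) : Prop :=
  m \in A /\ forall a, a \in A -> a <= m.

(* The difference of cardinalities is taken in int: it may be negative. *)
Definition sum_surplus_max (t : nat) : Prop :=
  exists A : {fset int},
    [/\ A != fset0,
        forall a, a \in A -> 0 < a,
        (#|` sumset A|%:Z - #|` diffset A|%:Z >= 10 * #|` A|%:Z)
      & is_max A t%:Z].

(* Main.v *)
(* Lower bound: [r >= 8 k] because an MSTD set has at least eight elements.  For
   a set of at most seven elements one decides, one after the other, which pairs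
   of positive differences coincide.  An equality is a linear relation between
   the gaps of the set and eliminates one of them, after which further sums
   become equal; a branch ends as soon as the sums that can still be distinct
   are outnumbered by the differences known to be distinct.  The resulting tree
   is small enough to be explored by evaluation.

   Upper bounds: an interval of length at least 20 splits into two MSTD sets, and
   one of length at least 46 into three.  Apart from a few short lengths this is
   done by a coloring whose two ends are fixed and whose middle alternates
   between two colors; lengthening the middle leaves the number of missing sums
   and of missing differences of a color class unchanged.  Concatenating
   intervals gives [R k <= 10 k] for even [k] and [R k <= 46 + 10 (k - 3)] for
   odd [k].

   The number [T] exists since in the fourth cartesian power of the eight-element
   MSTD set, with 26 sums and 25 differences, the surplus is
   [26 ^ 4 - 25 ^ 4 >= 10 * 8 ^ 4]; and [T >= 10] since a set of [n] elements
   has at most [n ^ 2] sums, so that [46 <= 4 T + 24]. *)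

From Stdlib Require Import ZArith Classical_Prop.
Require Import Defs.
From mathcomp Require Import zify ssrZ.

Set Implicit Arguments.
Unset Strict Implicit.
Unset Printing Implicit Defensive.
Import Order.TTheory GRing.Theory Num.Theory.

(** * Small sets have at most as many sums as differences *)

Section Search.
Local Open Scope Z_scope.
Local Arguments Z.mul : simpl never.

(** Missing coefficients count as zero, so that [dot_lincomb] holds for lists of any lengths. *)
Fixpoint lincomb (a b : Z) (u v : seq Z) : seq Z :=
  match u, v with
  | x :: u', y :: v' => a * x + b * y :: lincomb a b u' v'
  | [::], _ => map (Z.mul b) v
  | _, [::] => map (Z.mul a) u
  end.

Fixpoint dot (u : seq Z) (g : nat -> Z) : Z :=
  if u is x :: u' then x * g 0%nat + dot u' (g \o succn) else 0.

Definition vadd := lincomb 1 1.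
Definition vsub := lincomb 1 (-1).

Fixpoint half_sums (V : seq (seq Z)) : seq (seq Z) :=
  if V is v :: V' then [seq vadd v u | u <- V] ++ half_sums V' else [::].

Fixpoint half_diffs (V : seq (seq Z)) : seq (seq Z) :=
  if V is v :: V' then [seq vsub v u | u <- V'] ++ half_diffs V' else [::].

(* [V] lists the elements of the set as linear forms in the gaps, [D] positive
   differences with pairwise distinct values, [T] those still to be compared
   with [D].  Nested [if]s rather than boolean connectives, because [vm_compute]
   evaluates both sides of the latter. *)
Fixpoint search (fuel : nat) (V D T : seq (seq Z)) : bool :=
  if fuel is fuel'.+1 then
    if T is t :: T' then
      if t \in D then search fuel' V D T' else
      if ~~ uniq D then true else
      if ~~ all (has (Z.ltb 0)) D then true else
      if ~~ all (has (Z.ltb 0)) T then true else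
      if (size (undup (half_sums V)) <= (size D).*2.+1)%N then true else
      if all (fun u =>
                let w := vsub t u in
                if has (Z.ltb 0) w then
                  if has (Z.gtb 0) w then
                    let p := find (Z.ltb 0) w in
                    let wp := nth 0 w p in
                    let red v := lincomb wp (- nth 0 v p) v w in
                    search fuel' (map red V) (map red D) (map red T')
                  else true
                else has (Z.gtb 0) w) D
      then search fuel' V (t :: D) T' else false
    else (size (undup (half_sums V)) <= (size D).*2.+1)%N
  else false.

(* The elements of a set of size [n], relative to the smallest one, as sums of
   initial gaps. *)
Fixpoint staircase (n : nat) : seq (seq Z) :=
  if n is m.+1 then nseq m 0 :: map (cons 1) (staircase m) else [::].

(** [D] starts with the differences to the smallest element, which are distinct without any
    comparison. Each step of the search consumes a member of [T], so the fuel suffices. *)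
Definition search_size (n : nat) : bool :=
  let V := staircase n in
  let T := rev (half_diffs (rev V)) in
  search (size T).+1 V (map (fun v => vsub v (nth [::] V 0)) (behead V)) T.

Lemma dot_lincomb a b u v g :
  dot (lincomb a b u v) g = a * dot u g + b * dot v g.
Proof.
elim: u v g => [|x u IHu] [|y v] g /=; try lia.
- by elim: v g y => [|t v IHv] g y /=; [lia | rewrite IHv /=; lia].
- by clear IHu; elim: u g x => [|t u IHu] g x /=; [lia | rewrite IHu /=; lia].
- by rewrite IHu; lia.
Qed.

Lemma dot_vadd u v g : dot (vadd u v) g = dot u g + dot v g.
Proof. by rewrite dot_lincomb; lia. Qed.

Lemma dot_vsub u v g : dot (vsub u v) g = dot u g - dot v g.
Proof. by rewrite dot_lincomb; lia. Qed.

Lemma dot_nseq0 n g : dot (nseq n 0) g = 0.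
Proof. by elim: n g => [|n IHn] g //=; rewrite IHn. Qed.

Lemma dot_le0 u g : (forall i, 0 < g i) -> ~~ has (Z.ltb 0) u -> dot u g <= 0.
Proof.
elim: u g => [|x u IHu] g g0 //=; rewrite negb_or => /andP[x0 u0].
by have := IHu (g \o succn) (fun i => g0 _) u0; have := g0 0%nat; nia.
Qed.

Lemma dot_ge0 u g : (forall i, 0 < g i) -> ~~ has (Z.gtb 0) u -> 0 <= dot u g.
Proof.
elim: u g => [|x u IHu] g g0 //=; rewrite negb_or => /andP[x0 u0].
by have := IHu (g \o succn) (fun i => g0 _) u0; have := g0 0%nat; nia.
Qed.

Lemma dot_gt0 u g : (forall i, 0 < g i) ->
  has (Z.ltb 0) u -> ~~ has (Z.gtb 0) u -> 0 < dot u g.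
Proof.
elim: u g => [|x u IHu] g g0 //= /orP[x0|u0]; rewrite negb_or => /andP[x1 u1].
  by have := dot_ge0 (g := g \o succn) (fun i => g0 _) u1; have := g0 0%nat; nia.
by have := IHu (g \o succn) (fun i => g0 _) u0 u1; have := g0 0%nat; nia.
Qed.

Lemma dot_lt0 u g : (forall i, 0 < g i) ->
  ~~ has (Z.ltb 0) u -> has (Z.gtb 0) u -> dot u g < 0.
Proof.
elim: u g => [|x u IHu] g g0 //=; rewrite negb_or => /andP[x1 u1] /orP[x0|u0].
  by have := dot_le0 (g := g \o succn) (fun i => g0 _) u1; have := g0 0%nat; nia.
by have := IHu (g \o succn) (fun i => g0 _) u1 u0; have := g0 0%nat; nia.
Qed.

Definition sums (l : seq Z) := undup [seq x + y | x <- l, y <- l].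
Definition diffs (l : seq Z) := undup [seq x - y | x <- l, y <- l].

Lemma half_sumsP (V : seq (seq Z)) (g : nat -> Z) u v : u \in V -> v \in V ->
  dot u g + dot v g \in [seq dot s g | s <- undup (half_sums V)].
Proof.
move=> uV vV.
suff [s sV <-] : exists2 s, s \in half_sums V & dot s g = dot u g + dot v g.
  by apply: map_f; rewrite mem_undup.
elim: V uV vV => [|w V IHV] //; rewrite !inE.
have head a b : a = w -> b = w \/ b \in V ->
  exists2 s, s \in half_sums (w :: V) & dot s g = dot a g + dot b g.
  move=> -> bV; exists (vadd w b); last exact: dot_vadd.
  rewrite mem_cat; apply/orP; left; apply: (map_f (vadd w)).
  by rewrite inE; case: bV => [->|->]; rewrite ?eqxx ?orbT.
move=> /orP[/eqP uw|uV] /orP[/eqP vw|vV].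
- by apply: head => //; left.
- by apply: head => //; right.
- by have [s ? sE] := head v u vw (or_intror uV); exists s => //; lia.
- have [s sV <-] := IHV uV vV; exists s => //.
  by rewrite mem_cat sV orbT.
Qed.

(* Eliminations are fraction-free, hence the factor [c]. *)
Definition represents (g : nat -> Z) (c o : Z) (l : seq Z) (V : seq (seq Z)) :=
  [seq dot v g | v <- V] = [seq c * (x - o) | x <- l].

Definition positive_diff (g : nat -> Z) (c : Z) (l : seq Z) (v : seq Z) :=
  0 < dot v g /\ exists2 d, d \in diffs l & dot v g = c * d.

(** Equal forms have equal values and the map from [s] to [c * (s - 2 * o)] is injective, so
    distinct forms are at least as many as distinct sums, even if some of them still agree at
    [g]. *)
Lemma size_sums_le g c o l V : 0 < c -> represents g c o l V ->
  (size (sums l) <= size (undup (half_sums V)))%nat.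
Proof.
move=> c0 repV; rewrite -(size_map (fun v => dot v g)).
rewrite -[X in (X <= _)%nat](size_map (fun s => c * (s - 2 * o))); apply: uniq_leq_size.
  by rewrite map_inj_uniq ?undup_uniq // => x y; nia.
move=> _ /mapP[s + ->]; rewrite mem_undup => /allpairsP[[x y] /= [xl yl ->]].
have mem z : z \in l -> exists2 v, v \in V & dot v g = c * (z - o).
  move=> /(map_f (fun z => c * (z - o))); rewrite -repV => /mapP[v vV ->].
  by exists v.
have [u uV xE] := mem x xl; have [v vV yE] := mem y yl.
have -> : c * (x + y - 2 * o) = dot u g + dot v g by lia.
exact: half_sumsP.
Qed.

(** Zero, the differences given by [D] and their opposites are all distinct. *)
Lemma size_diffs_ge g c l D : l != [::] ->
  uniq [seq dot v g | v <- D] -> (forall v, v \in D -> positive_diff g c l v) ->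
  ((size D).*2.+1 <= size (diffs l))%nat.
Proof.
move=> l0 uD posD; set X := [seq dot v g | v <- D].
have posX x : x \in X -> 0 < x by move=> /mapP[v /posD[v0 _] ->].
have -> : (size D).*2.+1 = size (0 :: X ++ map Z.opp X).
  by rewrite /= size_cat !size_map addnn.
rewrite -[X in (_ <= X)%nat](size_map (Z.mul c)); apply: uniq_leq_size.
  rewrite /= cat_uniq uD map_inj_uniq ?uD /=; last by move=> x y; lia.
  rewrite andbT mem_cat negb_or -andbA; apply/and3P; split.
  - by apply/negP => /posX.
  - by apply/negP => /mapP[x /posX]; lia.
  - by apply/hasPn => _ /mapP[x /posX x0 ->]; apply/negP => /posX; lia.
have [y yl] : exists y, y \in l by case: (l) l0 => // y ? _; exists y; rewrite mem_head.
move=> x; rewrite inE mem_cat => /or3P[/eqP->|/mapP[v vD ->]|].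
- apply/mapP; exists 0; last by lia.
  by rewrite mem_undup; apply/allpairsP; exists (y, y); split => //=; lia.
- by have [_ [d dl ->]] := posD v vD; apply: map_f.
- move=> /mapP[_ /mapP[v vD ->] ->]; have [_ [d dl ->]] := posD v vD.
  apply/mapP; exists (- d); last by lia.
  move: dl; rewrite !mem_undup => /allpairsP[[a b] /= [al bl ->]].
  by apply/allpairsP; exists (b, a); split => //=; lia.
Qed.

(** Induction on the fuel. An exit with [true] either compares the two counts or contradicts an
    invariant: the values of [D] are distinct, and the forms in [D] and [T] are positive at [g].
    Otherwise the value of [t] is new, or it agrees with that of some [u] in [D] and the relation
    between them eliminates a gap. *)
Lemma search_sound fuel V D T g c o l : search fuel V D T ->
  (forall i, 0 < g i) -> 0 < c -> l != [::] -> represents g c o l V ->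
  uniq [seq dot v g | v <- D] ->
  (forall v, v \in D -> positive_diff g c l v) ->
  (forall v, v \in T -> positive_diff g c l v) ->
  (size (sums l) <= size (diffs l))%nat.
Proof.
move=> + g0 + l0.
have close V' D' c' : 0 < c' ->
    (size (undup (half_sums V')) <= (size D').*2.+1)%nat ->
    represents g c' o l V' -> uniq [seq dot v g | v <- D'] ->
    (forall v, v \in D' -> positive_diff g c' l v) ->
    (size (sums l) <= size (diffs l))%nat.
  move=> c'0 le_DV repV uD posD.
  apply: leq_trans (size_sums_le c'0 repV) _; apply: leq_trans le_DV _.
  exact: size_diffs_ge posD.
have neg_pos c' (X : seq (seq Z)) : ~~ all (has (Z.ltb 0)) X ->
    ~ (forall v, v \in X -> positive_diff g c' l v).
  move=> /allPn[v vX v0] /(_ v vX)[+ _].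
  by have := dot_le0 g0 v0; lia.
elim: fuel V D T c => [|fuel IHfuel] V D T c //=.
case: T => [|t T] + c0 repV uD posD posT; first by move=> /(close V D c c0); apply.
have posT' v : v \in T -> positive_diff g c l v.
  by move=> vT; apply: posT; rewrite inE vT orbT.
case: ifP => [tD|tD]; first by move=> /IHfuel/(_ c0); apply.
case: ifP => [/negP[]|_]; first exact: map_uniq uD.
case: ifP => [/neg_pos/(_ posD) //|_].
case: ifP => [/neg_pos/(_ posT) //|_].
case: ifP => [/(close V D c c0) le_sd _|_]; first exact: le_sd.
case: ifP => [/allP branches|//] new_diff.
have [/mapP[u uD' tE]|t_new] := boolP (dot t g \in [seq dot v g | v <- D]); last first.
  apply: (IHfuel _ _ _ c new_diff) => //=; first by rewrite t_new.
  by move=> v; rewrite inE => /predU1P[->|/posD //]; apply: posT; rewrite mem_head.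
move: (branches u uD'); set w := vsub t u => /=.
have w0 : dot w g = 0 by rewrite dot_vsub; lia.
(* A nonzero form without coefficients of both signs cannot vanish at positive gaps. *)
case: ifP => [wpos|/negbT wpos]; last by move=> wneg; have := dot_lt0 g0 wpos wneg; lia.
case: ifP => [wneg|/negbT wneg _]; last by have := dot_gt0 g0 wpos wneg; lia.
set wp := nth 0 w _; have wp0 : 0 < wp by have := nth_find 0 wpos; rewrite -/wp; lia.
(* [red v] is [wp * v] minus the multiple of [w] that clears the pivot coordinate. As [w] vanishes
   at [g], all values are multiplied by [wp > 0], and the scale becomes [wp * c]. *)
set red := fun v => _; have redE v : dot (red v) g = wp * dot v g.
  by rewrite dot_lincomb w0; lia.
have posred (X : seq (seq Z)) : (forall v, v \in X -> positive_diff g c l v) ->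
    forall v, v \in map red X -> positive_diff g (wp * c) l v.
  move=> posX _ /mapP[v /posX[v0 [d dl vE]] ->]; rewrite /positive_diff redE; split; first by nia.
  by exists d => //; rewrite vE; lia.
have wc0 : 0 < wp * c by nia.
move=> /IHfuel/(_ wc0); apply; [| |exact: posred|exact: posred].
- rewrite /represents -map_comp (eq_map (g := Z.mul wp \o fun v => dot v g)) //.
  by rewrite map_comp repV -map_comp; apply: eq_map => x /=; lia.
- rewrite -map_comp (eq_map (g := Z.mul wp \o fun v => dot v g)) //.
  by rewrite map_comp map_inj_uniq // => x y; nia.
Qed.

Lemma represents_staircase (l : seq Z) (g : nat -> Z) :
  (forall i, (i.+1 < size l)%nat -> g i = nth 0 l i.+1 - nth 0 l i) ->
  represents g 1 (head 0 l) l (staircase (size l)).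
Proof.
rewrite /represents; elim: l g => [|x l IHl] g gE //=.
rewrite dot_nseq0; congr (_ :: _); first by lia.
rewrite -map_comp; have /= := IHl (g \o succn) (fun i => gE i.+1).
case: l gE {IHl} => [|y l] // gE /(congr1 (map (Z.add (y - x)))).
rewrite -!map_comp => dE; have g0 : g 0%nat = y - x by exact: gE.
transitivity (map (Z.add (y - x) \o (dot^~ (g \o succn))) (staircase (size (y :: l)))).
  by apply: eq_map => v /=; rewrite g0; lia.
by rewrite dE; apply: eq_map => z /=; lia.
Qed.

(** [half_diffs] subtracts later entries from earlier ones, hence the decreasing order of [k]. *)
Lemma positive_half_diffs g c o l k V : 0 < c -> represents g c o k V ->
  sorted Z.gtb k -> {subset k <= l} ->
  forall v, v \in half_diffs V -> positive_diff g c l v.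
Proof.
move=> c0; elim: V k => [|u V IHV] [|x k] // [uE repV] sk kl v.
rewrite mem_cat => /orP[/mapP[w wV ->]|]; last first.
  apply: (IHV k) => //; first exact: path_sorted sk.
  by move=> y yk; apply: kl; rewrite inE yk orbT.
have /mapP[y yk yE] : dot w g \in [seq c * (x - o) | x <- k].
  by rewrite -repV; apply: map_f.
have lt_yx : y < x.
  have trans : transitive Z.gtb by move=> ? ? ?; lia.
  by have /allP/(_ y yk) := order_path_min trans sk; lia.
rewrite /positive_diff dot_vsub uE yE; split; first by nia.
exists (x - y); last by lia.
rewrite mem_undup; apply/allpairsP; exists (x, y); split => //=; apply: kl.
  by rewrite mem_head.
by rewrite inE yk orbT.
Qed.

Lemma size_sums_le_diffs (l : seq Z) : search_size (size l) -> sorted Z.ltb l ->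
  (size (sums l) <= size (diffs l))%nat.
Proof.
case: l => [|x l] // found srt; set L := x :: l in found srt *.
(* The value 1 past the last gap makes [g] positive at every index, as [search_sound] requires. *)
pose g i := if (i.+1 < size L)%nat then nth 0 L i.+1 - nth 0 L i else 1.
have g0 i : 0 < g i.
  rewrite /g; case: ltnP => // ltiL.
  by have /(sortedP 0)/(_ i ltiL) := srt; lia.
have repV : represents g 1 x L (staircase (size L)).
  by apply: represents_staircase => i ltiL; rewrite /g ltiL.
have srt_rev : sorted Z.gtb (rev L).
  by rewrite rev_sorted; apply: sub_sorted srt => a b; lia.
have posT v : v \in half_diffs (rev (staircase (size L))) -> positive_diff g 1 L v.
  apply: (positive_half_diffs (o := x) _ _ srt_rev) => //.
    by rewrite /represents !map_rev repV.
  by move=> y; rewrite mem_rev.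
have trans : transitive Z.ltb by move=> ? ? ?; lia.
have D_E : [seq dot v g | v <- [seq vsub v (nth [::] (staircase (size L)) 0)
    | v <- behead (staircase (size L))]] = [seq y - x | y <- l].
  rewrite -map_comp; have [/= v0 dE] := repV.
  transitivity [seq dot v g | v <- behead (staircase (size L))].
    by apply: eq_map => v /=; rewrite dot_vsub; lia.
  by rewrite [LHS]dE; apply: eq_map => y; lia.
apply: (search_sound found g0 _ _ repV) => //.
- rewrite D_E map_inj_uniq; last by move=> a b; lia.
  have : uniq L by apply: (sorted_uniq trans) srt => a; lia.
  by case/andP.
- move=> v /(map_f (fun v => dot v g)); rewrite D_E => /mapP[y yl yE].
  rewrite /positive_diff yE; split.
    by have /allP/(_ y yl) := order_path_min trans srt; lia.
  exists (y - x); last by lia.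
  rewrite mem_undup; apply/allpairsP; exists (y, x); split => //=.
    by rewrite inE yl orbT.
  by rewrite mem_head.
- by move=> v; rewrite mem_rev; apply: posT.
Qed.

Lemma search_size_le7 n : (n < 8)%nat -> search_size n.
Proof. by do 8?[case: n => [_|n]; first by vm_compute]. Qed.

End Search.

(** * Sumsets and difference sets of finite sets of integers *)

Section SumDifference.
Local Open Scope fset_scope.
Local Open Scope ring_scope.
Implicit Types (A B S : {fset int}).

Lemma sumsetP A s :
  reflect (exists x y, [/\ x \in A, y \in A & s = x + y]) (s \in sumset A).
Proof.
apply: (iffP (imfset2P _ _ _ _ _)) => [[x xA [y yA ->]]|[x [y [xA yA ->]]]].
  by exists x, y.
by exists x => //; exists y.
Qed.

Lemma diffsetP A d :
  reflect (exists x y, [/\ x \in A, y \in A & d = x - y]) (d \in diffset A).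
Proof.
apply: (iffP (imfset2P _ _ _ _ _)) => [[x xA [y yA ->]]|[x [y [xA yA ->]]]].
  by exists x, y.
by exists x => //; exists y.
Qed.

Lemma card_fset_seq (K : choiceType) (X : {fset K}) (s : seq K) :
  X =i s -> #|` X| = size (undup s).
Proof.
move=> Xs; apply/perm_size/uniq_perm; rewrite ?undup_uniq ?fset_uniq // => x.
by rewrite mem_undup -Xs.
Qed.

Lemma card_sumset_seq A s : A =i s ->
  #|` sumset A| = size (undup [seq x + y | x <- s, y <- s]).
Proof.
move=> As; apply: card_fset_seq => z; apply/sumsetP/allpairsP.
  by move=> [x [y [xA yA ->]]]; exists (x, y); rewrite -!As.
by move=> [[x y] /= []]; rewrite -!As => xA yA ->; exists x, y.
Qed.

Lemma card_diffset_seq A s : A =i s ->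
  #|` diffset A| = size (undup [seq x - y | x <- s, y <- s]).
Proof.
move=> As; apply: card_fset_seq => z; apply/diffsetP/allpairsP.
  by move=> [x [y [xA yA ->]]]; exists (x, y); rewrite -!As.
by move=> [[x y] /= []]; rewrite -!As => xA yA ->; exists x, y.
Qed.

Lemma size_undup_map (T1 T2 : eqType) (f : T1 -> T2) (s : seq T1) :
  injective f -> size (undup (map f s)) = size (undup s).
Proof. by move=> f_inj; rewrite undup_map_inj // size_map. Qed.

(** The elements in increasing order, transported to [Z], form a list to which the search
    applies. *)
Lemma MSTD_card_ge8 A : MSTD A -> (8 <= #|` A|)%N.
Proof.
apply: contraLR; rewrite -ltnNge -leqNgt => A8.
set s := sort <=%R (enum_fset A).
have As : A =i s by move=> x; rewrite mem_sort.
pose l := map Z_of_int s.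
have sz_l : size l = #|` A| by rewrite size_map size_sort.
have srt : sorted Z.ltb l.
  rewrite sorted_map; apply: (@sub_sorted _ <%R); first by move=> x y /=; lia.
  by rewrite lt_sorted_uniq_le sort_uniq fset_uniq sort_le_sorted.
have inj : injective Z_of_int := can_inj Z_of_intK.
have sumsE : size (sums l) = size (undup [seq x + y | x <- s, y <- s]).
  rewrite /sums /diffs /l -(size_undup_map _ inj) map_allpairs allpairs_mapl allpairs_mapr.
  by congr (size (undup _)); apply: eq_allpairs => x y /=; lia.
have diffsE : size (diffs l) = size (undup [seq x - y | x <- s, y <- s]).
  rewrite /sums /diffs /l -(size_undup_map _ inj) map_allpairs allpairs_mapl allpairs_mapr.
  by congr (size (undup _)); apply: eq_allpairs => x y /=; lia.
rewrite (card_sumset_seq As) (card_diffset_seq As) -sumsE -diffsE.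
by apply: size_sums_le_diffs => //; apply: search_size_le7; rewrite sz_l.
Qed.

End SumDifference.

(** * Decompositions into MSTD sets *)

Section Decompositions.
Local Open Scope fset_scope.
Local Open Scope ring_scope.
Implicit Types (A B S : {fset int}).

Lemma MSTD_neq0 A : MSTD A -> A != fset0.
Proof. by move=> /MSTD_card_ge8; rewrite -cardfs_gt0; apply: leq_trans. Qed.

Lemma mem_fcover (P : {fset {fset int}}) x :
  reflect (exists2 A, A \in P & x \in A) (x \in fcover P).
Proof.
apply: (iffP (bigfcupP _ _ _ _)) => [[A]|[A AP xA]]; first by rewrite andbT; exists A.
by exists A => //; rewrite AP.
Qed.

Lemma MSTD_decomposable0 : MSTD_decomposable 0 fset0.
Proof.
exists fset0; split; last by move=> A; rewrite inE.
split; rewrite ?cardfs0 //; try by move=> A; rewrite inE.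
by apply/fsetP => x; rewrite inE; apply/mem_fcover => -[A]; rewrite inE.
Qed.

Lemma MSTD_decomposable1 A : MSTD A -> MSTD_decomposable 1 A.
Proof.
move=> mA; exists [fset A]; split; last by move=> B /fset1P ->.
split; first exact: cardfs1.
- by move=> B /fset1P ->; apply: MSTD_neq0.
- by move=> B C /fset1P -> /fset1P ->; rewrite eqxx.
- apply/fsetP => x; apply/mem_fcover/idP => [[B /fset1P -> //]|xA].
  by exists A; rewrite ?inE.
Qed.

Lemma MSTD_decomposableU k l A B : MSTD_decomposable k A ->
  MSTD_decomposable l B -> [disjoint A & B] ->
  MSTD_decomposable (k + l) (A `|` B).
Proof.
move=> [P [[Pk P0 Pd PA] Pm]] [Q [[Ql Q0 Qd QB] Qm]] /fdisjointP dAB.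
have subP C : C \in P -> {subset C <= A}.
  by move=> CP x xC; rewrite -PA; apply/mem_fcover; exists C.
have subQ C : C \in Q -> {subset C <= B}.
  by move=> CQ x xC; rewrite -QB; apply/mem_fcover; exists C.
have dPQ C D : C \in P -> D \in Q -> [disjoint C & D].
  move=> CP DQ; apply/fdisjointP => x /(subP C CP)/dAB; apply: contra.
  exact: subQ.
exists (P `|` Q); split; last by move=> C /fsetUP[/Pm|/Qm].
split.
(* A common member of [P] and [Q] would be disjoint from itself, hence empty, which [P0]
   excludes. *)
- rewrite cardfsU Pk Ql; suff /eqP -> : P `&` Q == fset0 by rewrite cardfs0 subn0.
  rewrite fsetI_eq0; apply/fdisjointP => C CP; apply/negP => CQ.
  have := P0 C CP; have := dPQ C C CP CQ.
  by rewrite -fsetI_eq0 fsetIid => ->.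
- by move=> C /fsetUP[/P0|/Q0].
- move=> C D /fsetUP[CP|CQ] /fsetUP[DP|DQ] CD; [exact: Pd|exact: dPQ| |exact: Qd].
  by rewrite fdisjoint_sym; apply: dPQ.
- apply/fsetP => x; rewrite inE -PA -QB; apply/mem_fcover/orP.
    by move=> [C /fsetUP[CP|CQ] xC]; [left|right]; apply/mem_fcover; exists C.
  by move=> [/mem_fcover[C ? ?]|/mem_fcover[C ? ?]]; exists C; rewrite // inE;
    apply/orP; [left|right].
Qed.

Definition translate (t : int) A : {fset int} := [fset x + t | x in A].

Lemma mem_translate t A x : (x \in translate t A) = (x - t \in A).
Proof.
apply/imfsetP/idP => [[y /= yA ->]|xA]; first by rewrite addrK.
by exists (x - t); rewrite ?subrK.
Qed.

Lemma translate_inj t : injective (translate t).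
Proof.
move=> A B AB; apply/fsetP => x.
by rewrite -[x](addrK t) -!mem_translate AB.
Qed.

Lemma card_translate t A : #|` translate t A| = #|` A|.
Proof. exact/card_imfset/addIr. Qed.

Lemma diffset_translate t A : diffset (translate t A) = diffset A.
Proof.
apply/fsetP => x; apply/diffsetP/diffsetP => -[y [z [yA zA ->]]].
  by exists (y - t), (z - t); rewrite -!mem_translate; split=> //; lia.
by exists (y + t), (z + t); rewrite !mem_translate !addrK; split=> //; lia.
Qed.

Lemma sumset_translate t A : sumset (translate t A) = translate (t + t) (sumset A).
Proof.
apply/fsetP => x; rewrite mem_translate; apply/sumsetP/sumsetP => -[y [z [yA zA xE]]].
  by exists (y - t), (z - t); rewrite -!mem_translate; split=> //; lia.
by exists (y + t), (z + t); rewrite !mem_translate !addrK; split=> //; lia.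
Qed.

Lemma MSTD_translate t A : MSTD A -> MSTD (translate t A).
Proof. by rewrite /MSTD diffset_translate sumset_translate card_translate. Qed.

Lemma MSTD_decomposable_translate t k A :
  MSTD_decomposable k A -> MSTD_decomposable k (translate t A).
Proof.
move=> [P [[Pk P0 Pd PA] Pm]]; exists [fset translate t C | C in P].
have mem C : C \in [fset translate t C | C in P] ->
    exists2 D, D \in P & C = translate t D by move=> /imfsetP.
split; last by move=> C /mem[D /Pm mD ->]; apply: MSTD_translate.
split.
- by rewrite -Pk; apply: card_imfset; apply: translate_inj.
- by move=> C /mem[D /Pm mD ->]; apply/MSTD_neq0/MSTD_translate.
- move=> C D /mem[C' CP ->] /mem[D' DP ->] CD.
  have /fdisjointP dCD : [disjoint C' & D'].
    by apply: Pd => //; apply: contraNneq CD => ->.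
  by apply/fdisjointP => x; rewrite !mem_translate => /dCD.
- apply/fsetP => x; rewrite mem_translate -PA; apply/mem_fcover/mem_fcover.
    by move=> [C /mem[D DP ->]]; rewrite mem_translate; exists D.
  move=> [D DP xD]; exists (translate t D); first exact: in_imfset.
  by rewrite mem_translate.
Qed.

Lemma MSTD_decomposable_card k A : MSTD_decomposable k A -> (8 * k <= #|` A|)%N.
Proof.
move=> [P [[<- _ Pd <-] Pm]].
have /trivIfsetP/eqP <- := Pd : {in P &, forall B C, B != C -> [disjoint B & C]}.
rewrite -iter_addn_0 -(count_predT (enum_fset P)) -big_const_seq.
rewrite big_seq [X in (_ <= X)%N]big_seq.
by apply: leq_sum => B /Pm/MSTD_card_ge8.
Qed.

Lemma mem_initial_interval r x :
  (x \in initial_interval r) = (1 <= x <= r%:Z).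
Proof.
apply/imfsetP/idP => /= [[i + ->]|xr]; first by rewrite mem_iota; lia.
by exists `|x|%N; rewrite ?mem_iota; lia.
Qed.

Lemma card_initial_interval r : #|` initial_interval r| = r.
Proof.
have inj : injective Posz by move=> x y [].
by rewrite (card_imfset _ _ inj) /= undup_id ?size_iota ?iota_uniq.
Qed.

Lemma decomposable_interval_cat k l r s :
  MSTD_decomposable k (initial_interval r) ->
  MSTD_decomposable l (initial_interval s) ->
  MSTD_decomposable (k + l) (initial_interval (r + s)).
Proof.
move=> dr /(MSTD_decomposable_translate r%:Z) ds.
have -> : initial_interval (r + s) =
    initial_interval r `|` translate r%:Z (initial_interval s).
  by apply/fsetP => x; rewrite inE mem_translate !mem_initial_interval; lia.
apply: MSTD_decomposableU => //; apply/fdisjointP => x.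
by rewrite mem_translate !mem_initial_interval; lia.
Qed.

End Decompositions.

(** * Sets with a stretchable middle *)

Section Growth.
Local Open Scope fset_scope.
Local Open Scope ring_scope.
Implicit Types (A : {fset int}) (L R : seq int).

(** Sums within and between a left fringe [L] and a right fringe [R], cut at two thresholds. When
    [R] moves by [2 * m], the three kinds of sums move by [0], [2 * m] and [4 * m]. *)
Definition low_sums L h := undup [seq s <- [seq x + y | x <- L, y <- L] | s < h].
Definition cross_sums L R h h' :=
  undup [seq s <- [seq x + y | x <- L, y <- R] | (h <= s) && (s < h')].
Definition high_sums R h' := undup [seq s <- [seq x + y | x <- R, y <- R] | h' <= s].
Definition long_diffs L R (e : nat) :=
  undup [seq d <- [seq x - y | x <- R, y <- L] | e%:Z <= d].

(** The middle is the progression [u, u + 2, ..., u + 2 * m - 2], and [R] is moved by [2 * m]. The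
    bounds by [e] ensure that a difference [x - y] can reach [e + 2 * m] only for [x] in the moved
    [R] and [y] in [L]. *)
Definition growable L R (u p q : int) (e : nat) : bool :=
  [&& p \in L, p + 1 \in L, q \in R, q + 1 \in R & p <= q] &&
  [&& all (fun z => (z - u < e%:Z) && (u - 2 - z < e%:Z)) (L ++ R),
      all (fun x => all (fun y => x - y < e%:Z) (L ++ R)) L,
      all (fun x => all (fun y => x - y < e%:Z) R) R, (0 < e)%N
    & ((e + size (long_diffs L R e)).*2 <=
         size (low_sums L (p + u)%R) + size (cross_sums L R (p + u)%R (q + u)%R)
         + size (high_sums R (q + u)%R))%N].

(* The runs [p, p + 1] and [q, q + 1] added to the progression of step [2]
   fill whole intervals, so [m] more terms give [4 * m] more sums; differences
   below [e + 2 * m] are counted as if all occurred, and longer ones only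
   arise between the two fringes. *)
Lemma MSTD_growable A L R u p q e m : growable L R u p q e ->
  (forall x, x \in A <-> [\/ x \in L,
     exists2 i, (i < m)%N & x = u + (2 * i)%:Z | x - (2 * m)%:Z \in R]) ->
  MSTD A.
Proof.
move=> /andP[/and5P[pL pL' qR qR' pq] /and5P[/allP zLR /allP LLR /allP RR e0 card_le]] AE.
have inL x : x \in L -> x \in A by move=> xL; apply/AE/Or31.
have inM i : (i < m)%N -> u + (2 * i)%:Z \in A by move=> im; apply/AE/Or32; exists i.
have inR x : x \in R -> x + (2 * m)%:Z \in A by move=> xR; apply/AE/Or33; rewrite addrK.
pose run (h : int) n : seq int := [seq h + j%:Z | j <- iota 0 n].
have mem_run h n x : (x \in run h n) = (h <= x < h + n%:Z).
  apply/mapP/idP => [[j + ->]|hx]; first by rewrite mem_iota; lia.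
  by exists (absz (x - h)%R); rewrite ?mem_iota; lia.
have uniq_run h n : uniq (run h n).
  by rewrite map_inj_uniq ?iota_uniq // => i j; lia.
have size_run h n : size (run h n) = n by rewrite size_map size_iota.
(* [S1] to [S5] lie in consecutive disjoint ranges; [S2] and [S4] contribute the [4 * m] new
   sums. *)
pose S1 : seq int := low_sums L (p + u).
pose S2 : seq int := run (p + u) (2 * m)%N.
pose S3 : seq int := [seq s + (2 * m)%:Z | s <- cross_sums L R (p + u) (q + u)].
pose S4 : seq int := run (q + u + (2 * m)%:Z) (2 * m)%N.
pose S5 : seq int := [seq s + (4 * m)%:Z | s <- high_sums R (q + u)].
have S1E x : x \in S1 -> x < p + u /\ x \in sumset A.
  rewrite mem_undup mem_filter => /andP[xh /allpairsP[[a b] /= [aL bL xE]]].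
  by split=> //; apply/sumsetP; exists a, b; split; rewrite ?inL.
have S2E x : x \in S2 -> (p + u <= x < p + u + (2 * m)%:Z) /\ x \in sumset A.
  rewrite mem_run => xh; split=> //; apply/sumsetP.
  (* The parity of [j] chooses between [p] and [p + 1], and [j./2] is the index of the middle
     term. *)
  pose j := absz (x - (p + u))%R; have jE : x = p + u + j%:Z by lia.
  have jm : (j./2 < m)%N by lia.
  exists (p + (odd j)%:Z), (u + (2 * j./2)%:Z); split; [|exact: inM|lia].
  by apply: inL; case: (odd j); rewrite ?addr0.
have S3E x : x \in S3 ->
    (p + u + (2 * m)%:Z <= x < q + u + (2 * m)%:Z) /\ x \in sumset A.
  move=> /mapP[s + ->]; rewrite mem_undup mem_filter.
  move=> /andP[sh /allpairsP[[a b] /= [aL bR sE]]].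
  split; first lia; apply/sumsetP; exists a, (b + (2 * m)%:Z).
  by split; [exact: inL|exact: inR|lia].
have S4E x : x \in S4 ->
    (q + u + (2 * m)%:Z <= x < q + u + (4 * m)%:Z) /\ x \in sumset A.
  rewrite mem_run => xh; split; first lia; apply/sumsetP.
  pose j := absz (x - (q + u + (2 * m)%:Z))%R.
  have jE : x = q + u + (2 * m)%:Z + j%:Z by lia.
  have jm : (j./2 < m)%N by lia.
  exists (q + (odd j)%:Z + (2 * m)%:Z), (u + (2 * j./2)%:Z); split; [|exact: inM|lia].
  by apply: inR; case: (odd j); rewrite ?addr0.
have S5E x : x \in S5 -> q + u + (4 * m)%:Z <= x /\ x \in sumset A.
  move=> /mapP[s + ->]; rewrite mem_undup mem_filter.
  move=> /andP[sh /allpairsP[[a b] /= [aL bR sE]]].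
  split; first lia; apply/sumsetP; exists (a + (2 * m)%:Z), (b + (2 * m)%:Z).
  by split; [exact: inR|exact: inR|lia].
have sums_ge : (size (S1 ++ S2 ++ S3 ++ S4 ++ S5) <= #|` sumset A|)%N.
  apply: uniq_leq_size; last first.
    by move=> x; rewrite !mem_cat => /or4P[/S1E[]|/S2E[]|/S3E[]|/orP[/S4E[]|/S5E[]]].
  have u3 : uniq S3 by rewrite map_inj_uniq ?undup_uniq //; apply: addIr.
  have u5 : uniq S5 by rewrite map_inj_uniq ?undup_uniq //; apply: addIr.
  rewrite !cat_uniq u3 u5 !uniq_run undup_uniq /= !andbT.
  apply/and4P; split; apply/hasPn => x; rewrite ?mem_cat.
  - move=> xS; apply/negP => /S1E[+ _].
    by move: xS => /or4P[/S2E[]|/S3E[]|/S4E[]|/S5E[]]; lia.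
  - move=> xS; apply/negP => /S2E[+ _].
    by move: xS => /or3P[/S3E[]|/S4E[]|/S5E[]]; lia.
  - move=> xS; apply/negP => /S3E[+ _].
    by move: xS => /orP[/S4E[]|/S5E[]]; lia.
  - by move=> /S5E[x5 _]; apply/negP => /S4E[]; lia.
pose D1 : seq int := [seq d + (2 * m)%:Z | d <- long_diffs L R e].
(* All integers of absolute value less than [e + 2 * m]. Their number is [2 * (e + 2 * m) - 1], and
   this [- 1] makes the final inequality strict. *)
pose D0 : seq int := run (1 - (e + 2 * m)%:Z) (e + 2 * m).*2.-1.
have long x y : x \in A -> y \in A -> (e + 2 * m)%:Z <= x - y -> x - y \in D1.
  have zL z : z \in L -> (z - u < e%:Z) && (u - 2 - z < e%:Z).
    by move=> zL; apply: zLR; rewrite mem_cat zL.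
  have zR z : z \in R -> (z - u < e%:Z) && (u - 2 - z < e%:Z).
    by move=> zR; apply: zLR; rewrite mem_cat zR orbT.
  have LL a b : a \in L -> b \in L -> a - b < e%:Z.
    by move=> /LLR/allP ab bL; apply: ab; rewrite mem_cat bL.
  have LR a b : a \in L -> b \in R -> a - b < e%:Z.
    by move=> /LLR/allP ab bL; apply: ab; rewrite mem_cat bL orbT.
  have {}RR a b : a \in R -> b \in R -> a - b < e%:Z by move=> /RR/allP; apply.
  move=> /AE[xL|[i im xE]|xR] /AE[yL|[j jm yE]|yR].
  - by have := LL x y xL yL; lia.
  - by have := zL x xL; lia.
  - by have := LR _ _ xL yR; lia.
  - by have := zL y yL; lia.
  - by lia.
  - by have := zR _ yR; lia.
  - move=> xy; apply/mapP; exists (x - (2 * m)%:Z - y); last by lia.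
    rewrite mem_undup mem_filter; apply/andP; split; first by lia.
    by apply/allpairsP; exists (x - (2 * m)%:Z, y).
  - by have := zR _ xR; lia.
  - by have := RR _ _ xR yR; lia.
have diffs_le : (#|` diffset A| <= size (D0 ++ D1 ++ map -%R D1))%N.
  apply: uniq_leq_size; first exact: fset_uniq.
  move=> _ /diffsetP[x [y [xA yA ->]]]; rewrite !mem_cat mem_run.
  have [xy|xy] := boolP ((e + 2 * m)%:Z <= x - y); first by rewrite long ?orbT.
  have [yx|yx] := boolP ((e + 2 * m)%:Z <= y - x); last by apply/orP; left; lia.
  by rewrite -(opprB y x) map_f ?orbT // long.
rewrite /MSTD; apply: leq_ltn_trans diffs_le _; apply: leq_trans sums_ge.
rewrite !size_cat /S1 /S2 /S3 /S4 /S5 /D0 /D1 !size_run !size_map.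
move: card_le e0; set a := size (low_sums _ _); set b := size (cross_sums _ _ _ _).
by set c := size (high_sums _ _); set d := size (long_diffs _ _ _); lia.
Qed.

End Growth.

(** * Colorings of intervals *)

Section Colorings.
Local Open Scope fset_scope.
Local Open Scope ring_scope.
Implicit Types (A : {fset int}) (w : seq nat).

(* Off by one: the letter at index [x - 1] of [w] is the color of the integer [x]. *)
Definition color_class (i : nat) w : {fset int} :=
  [fset x in initial_interval (size w) | nth 0%N w (absz x).-1 == i].

(** A list, for evaluation; [o] is the number of letters standing before [w]. *)
Definition positions (o i : nat) w : seq int :=
  [seq (o + j).+1%:Z | j <- iota 0 (size w) & nth 0%N w j == i].

Definition MSTD_seq (s : seq int) : bool :=
  (size (undup [seq (x - y)%R | x <- s, y <- s]) <
   size (undup [seq (x + y)%R | x <- s, y <- s]))%N.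

Lemma MSTD_seqP A s : A =i s -> MSTD A = MSTD_seq s.
Proof. by move=> As; rewrite /MSTD (card_sumset_seq As) (card_diffset_seq As). Qed.

Lemma mem_color_class i w x :
  (x \in color_class i w) = (1 <= x <= (size w)%:Z) && (nth 0%N w (absz x).-1 == i).
Proof. by rewrite !inE mem_initial_interval. Qed.

Lemma mem_positions o i w x : (x \in positions o i w) =
  (o%:Z < x <= (o + size w)%:Z) && (nth 0%N w (absz (x - o%:Z)%R).-1 == i).
Proof.
apply/mapP/andP => [[j + ->]|[xw xi]].
  rewrite mem_filter mem_iota => /andP[ji jw]; split; first by lia.
  by rewrite (_ : _.-1 = j) //; lia.
exists (absz (x - o%:Z)%R).-1; last by lia.
by rewrite mem_filter mem_iota xi /=; lia.
Qed.

Lemma color_class_positions i w : color_class i w =i positions 0 i w.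
Proof. by move=> x; rewrite mem_color_class mem_positions subr0; congr (_ && _); lia. Qed.

(** Induction on the number [j] of colors: [U j] collects the integers of color less than [j], and
    the class of color [j] joins it as a new part. *)
Lemma coloring_decomposable k w : all (fun c => c < k)%N w ->
  (forall i, (i < k)%N -> MSTD (color_class i w)) ->
  MSTD_decomposable k (initial_interval (size w)).
Proof.
move=> /(all_nthP 0%N) wk mw.
have {}wk j : (j < size w)%N -> (nth 0%N w j < k)%N := wk j.
pose U j := [fset x in initial_interval (size w) | (nth 0%N w (absz x).-1 < j)%N].
have memU j x : (x \in U j) =
    (1 <= x <= (size w)%:Z) && (nth 0%N w (absz x).-1 < j)%N.
  by rewrite !inE mem_initial_interval.
suff dU j : (j <= k)%N -> MSTD_decomposable j (U j).
  suff -> : initial_interval (size w) = U k by apply: dU.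
  apply/fsetP => x; rewrite memU mem_initial_interval; case: (boolP (1 <= x <= _)) => //= xw.
  by rewrite wk //; lia.
elim: j => [_|j IHj jk].
  suff -> : U 0%N = fset0 by apply: MSTD_decomposable0.
  by apply/fsetP => x; rewrite memU ltn0 andbF inE.
have -> : U j.+1 = U j `|` color_class j w.
  by apply/fsetP => x; rewrite inE !memU mem_color_class ltnS leq_eqVlt; lia.
rewrite -addn1; apply: MSTD_decomposableU; first by apply: IHj; apply: ltnW.
  by apply/MSTD_decomposable1/mw.
by apply/fdisjointP => x; rewrite memU mem_color_class; lia.
Qed.

Definition stretch (l r : seq nat) (m : nat) : seq nat :=
  l ++ flatten (nseq m [:: 0; 1]%N) ++ r.

Lemma size_alternating m : size (flatten (nseq m [:: 0; 1]%N)) = (2 * m)%N.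
Proof. by elim: m => //= m ->; lia. Qed.

Lemma size_stretch l r m : size (stretch l r m) = (size l + 2 * m + size r)%N.
Proof. by rewrite !size_cat size_alternating addnA. Qed.

Lemma nth_alternating m j : (j < 2 * m)%N ->
  nth 0%N (flatten (nseq m [:: 0; 1]%N)) j = odd j.
Proof.
elim: m j => [|m IHm] [|[|j]] //= jm; rewrite negbK; apply: IHm; lia.
Qed.

Lemma all_alternating k m : (1 < k)%N ->
  all (fun c => c < k)%N (flatten (nseq m [:: 0; 1]%N)).
Proof. by move=> k1; elim: m => //= m ->; rewrite k1 ltnW. Qed.

(** Color [i] occupies every second place of the middle, starting at [(size l + i).+1]. The word [r]
    is located as for [m = 0], since [MSTD_growable] itself moves the right fringe. *)
Lemma MSTD_color_class_stretch l r i p q e m : (i < 2)%N ->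
  growable (positions 0 i l) (positions (size l) i r) (size l + i).+1%:Z p q e ->
  MSTD (color_class i (stretch l r m)).
Proof.
move=> i2 /(MSTD_growable (m := m)); apply => x.
rewrite mem_color_class size_stretch !mem_positions !nth_cat size_alternating.
split=> [/andP[xw]|].
  case: ltnP => [xl xi|lx]; first by apply: Or31; rewrite subr0 xi; lia.
  case: ltnP => [xm|mx xi].
    rewrite nth_alternating // => /eqP xi; apply: Or32.
    by exists (((absz x).-1 - size l)./2); lia.
  apply: Or33; rewrite (_ : _.-1 = ((absz x).-1 - size l - 2 * m)%N); last by lia.
  by rewrite xi; lia.
case=> [/andP[xl]|[j jm xE]|/andP[xr]].
- rewrite subr0 => xi; rewrite ifT; last by lia.
  by rewrite xi; lia.
- rewrite ifF; last by lia.
  rewrite ifT; last by lia.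
  by rewrite nth_alternating; lia.
- rewrite (_ : _.-1 = ((absz x).-1 - size l - 2 * m)%N); last by lia.
  move=> xi; rewrite ifF; last by lia.
  rewrite ifF; last by lia.
  by rewrite xi; lia.
Qed.

(** Each triple holds the parameters [p], [q], [e] of [growable] for one color. *)
Definition stretchable (l r : seq nat) (c0 c1 : int * int * nat) : bool :=
  let ok i c := growable (positions 0 i l) (positions (size l) i r)
                  (size l + i).+1%:Z c.1.1 c.1.2 c.2 in
  ok 0%N c0 && ok 1%N c1.

Lemma stretch_decomposable2 l r c0 c1 m :
  stretchable l r c0 c1 -> all (fun c => c < 2)%N (l ++ r) ->
  MSTD_decomposable 2 (initial_interval (size l + 2 * m + size r)).
Proof.
move=> /andP[ok0 ok1]; rewrite all_cat => /andP[l2 r2].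
rewrite -size_stretch; apply: coloring_decomposable.
  by rewrite !all_cat l2 r2 all_alternating.
move=> [|[|i]] // _; first exact: MSTD_color_class_stretch ok0.
exact: MSTD_color_class_stretch ok1.
Qed.

(** Color 2 occurs only in [l], so its class is the same for every [m] and a single test
    suffices. *)
Lemma stretch_decomposable3 l r c0 c1 m :
  stretchable l r c0 c1 -> all (fun c => c < 3)%N l -> all (fun c => c < 2)%N r ->
  MSTD_seq (positions 0 2 l) ->
  MSTD_decomposable 3 (initial_interval (size l + 2 * m + size r)).
Proof.
move=> /andP[ok0 ok1] l3 r2 m2.
rewrite -size_stretch; apply: coloring_decomposable.
  rewrite !all_cat l3 all_alternating //=.
  by apply: sub_all r2 => c; apply: ltnW.
move=> [|[|[|i]]] // _; first exact: MSTD_color_class_stretch ok0.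
  exact: MSTD_color_class_stretch ok1.
suff class2 (x : int) : (x \in color_class 2 (stretch l r m)) = (x \in positions 0 2 l).
  by rewrite (MSTD_seqP class2).
rewrite mem_color_class size_stretch mem_positions !nth_cat size_alternating subr0.
case: ltnP => [xl|lx]; first by congr (_ && _); lia.
rewrite [X in _ = X && _](_ : _ = false); last by lia.
case: ltnP => [xm|mx]; first by rewrite nth_alternating //; lia.
apply/negP => /andP[xw /eqP xi].
suff : (nth 0 r ((absz x).-1 - size l - 2 * m) < 2)%N by rewrite xi.
by apply/(all_nthP 0%N r2); lia.
Qed.

End Colorings.

(** * Existence of decompositions *)

Section Existence.
Local Open Scope fset_scope.
Local Open Scope ring_scope.
Implicit Types (A X Y : {fset int}).

(* The words below, and the parameters [p], [q], [e] of [growable], come from a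
   computer search by simulated annealing. *)
Lemma decomposable2_even r : (24 <= r)%N -> ~~ odd r ->
  MSTD_decomposable 2 (initial_interval r).
Proof.
move=> r_ge r_par; have -> : r = (12 + 2 * (r - 24)./2 + 12)%N by lia.
by apply: (stretch_decomposable2
  (l := [:: 1; 1; 1; 1; 0; 0; 1; 0; 0; 1; 1; 1]%N)
  (r := [:: 0; 0; 0; 0; 1; 1; 0; 1; 1; 0; 0; 0]%N)
  (c0 := (5, 13, 12%N)) (c1 := (10, 20, 12%N)));
  vm_compute.
Qed.

Lemma decomposable2_odd r : (29 <= r)%N -> odd r ->
  MSTD_decomposable 2 (initial_interval r).
Proof.
move=> r_ge r_par; have -> : r = (14 + 2 * (r - 29)./2 + 15)%N by lia.
by apply: (stretch_decomposable2
  (l := [:: 0; 0; 1; 0; 1; 1; 1; 0; 0; 1; 0; 1; 1; 1]%N)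
  (r := [:: 0; 1; 1; 0; 1; 0; 0; 0; 1; 1; 0; 1; 0; 0; 0]%N)
  (c0 := (1, 20, 15%N)) (c1 := (5, 23, 12%N)));
  vm_compute.
Qed.

Lemma decomposable3_even r : (46 <= r)%N -> ~~ odd r ->
  MSTD_decomposable 3 (initial_interval r).
Proof.
move=> r_ge r_par; have -> : r = (28 + 2 * (r - 46)./2 + 18)%N by lia.
by apply: (stretch_decomposable3
  (l := [:: 1; 1; 2; 1; 2; 2; 2; 1; 1; 2; 1; 0; 0; 2; 2; 0; 2; 0; 0; 0; 1; 1; 1; 1; 0; 1; 0; 1]%N)
  (r := [:: 0; 0; 0; 0; 1; 1; 1; 0; 0; 1; 0; 1; 1; 1; 0; 0; 1; 0]%N)
  (c0 := (12, 29, 18%N)) (c1 := (8, 40, 28%N)));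
  vm_compute.
Qed.

Lemma decomposable3_odd r : (47 <= r)%N -> odd r ->
  MSTD_decomposable 3 (initial_interval r).
Proof.
move=> r_ge r_par; have -> : r = (28 + 2 * (r - 47)./2 + 19)%N by lia.
by apply: (stretch_decomposable3
  (l := [:: 0; 0; 0; 1; 0; 0; 1; 1; 1; 1; 0; 0; 2; 1; 2; 2; 2; 0; 1; 2; 1; 1; 0; 2; 2; 0; 2; 1]%N)
  (r := [:: 0; 0; 1; 0; 1; 1; 0; 0; 0; 0; 1; 1; 1; 0; 1; 1; 0; 0; 0]%N)
  (c0 := (1, 35, 27%N)) (c1 := (7, 40, 25%N)));
  vm_compute.
Qed.

Lemma two_coloring_decomposable w :
  [&& all (fun c => c < 2)%N w, MSTD_seq (positions 0 0 w)
    & MSTD_seq (positions 0 1 w)] ->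
  MSTD_decomposable 2 (initial_interval (size w)).
Proof.
move=> /and3P[w2 m0 m1]; apply: coloring_decomposable => // -[|[|i]] // _;
  by rewrite (MSTD_seqP (color_class_positions _ _)).
Qed.

Lemma decomposable2 r : (20 <= r)%N -> MSTD_decomposable 2 (initial_interval r).
Proof.
move=> r20; have [even_big|small] := boolP (~~ odd r && (24 <= r))%N.
  by apply: decomposable2_even; case/andP: even_big.
have [odd_big|] := boolP (odd r && (29 <= r))%N.
  by apply: decomposable2_odd; case/andP: odd_big.
move=> small'.
(* These are the lengths from 20 on that neither stretchable family reaches. *)
have : r \in [:: 20; 21; 22; 23; 25; 27]%N by rewrite !inE; lia.
rewrite !inE => /or4P[/eqP->|/eqP->|/eqP->|/or3P[/eqP->|/eqP->|/eqP->]].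
- exact: (@two_coloring_decomposable
    [:: 0; 0; 0; 1; 0; 1; 1; 0; 0; 0; 1; 1; 1; 0; 1; 0; 0; 1; 1; 1]%N).
- exact: (@two_coloring_decomposable
    [:: 1; 0; 0; 1; 1; 1; 0; 1; 0; 0; 1; 1; 0; 0; 0; 1; 0; 1; 1; 0; 0]%N).
- exact: (@two_coloring_decomposable
    [:: 0; 1; 1; 0; 0; 0; 1; 0; 1; 1; 0; 0; 1; 1; 1; 0; 1; 0; 0; 1; 1; 0]%N).
- exact: (@two_coloring_decomposable
    [:: 1; 1; 1; 0; 0; 1; 0; 1; 1; 1; 0; 0; 0; 0; 1; 1; 0; 1; 0; 0; 0; 1; 1]%N).
- exact: (@two_coloring_decomposable
    [:: 0; 1; 1; 0; 1; 1; 0; 0; 0; 1; 1; 0; 1; 0; 0; 1; 0; 0; 1; 1; 1; 0; 0; 1; 0]%N).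
- exact: (@two_coloring_decomposable
    [:: 1; 1; 0; 0; 1; 0; 1; 0; 0; 1; 1; 1; 1; 1; 0; 0; 0; 1; 1; 0; 1; 0; 1; 1; 0; 0; 0]%N).
Qed.

Lemma decomposable3 r : (46 <= r)%N -> MSTD_decomposable 3 (initial_interval r).
Proof.
move=> r46; have [odd_r|even_r] := boolP (odd r).
  by apply: decomposable3_odd => //; lia.
exact: decomposable3_even.
Qed.

(** Blocks of length 20 are cut off at the upper end, each giving two more MSTD sets; what remains
    has length at least [s]. *)
Lemma decomposable_blocks k j r s :
  (forall t, (s <= t)%N -> MSTD_decomposable k (initial_interval t)) ->
  (s + 20 * j <= r)%N -> MSTD_decomposable (k + 2 * j) (initial_interval r).
Proof.
move=> dk; elim: j r => [|j IHj] r rj; first by rewrite addn0; apply: dk; lia.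
have -> : r = (r - 20 + 20)%N by lia.
have -> : (k + 2 * j.+1 = k + 2 * j + 2)%N by lia.
by apply: decomposable_interval_cat; [apply: IHj; lia|apply: decomposable2].
Qed.

(** * Sets with a large surplus of sums *)

(* For [M] large this is the cartesian product, with componentwise sums. *)
Definition pack (M : int) X Y : {fset int} := [fset x + M * y | x in X, y in Y].

Lemma packP M X Y z :
  reflect (exists x y, [/\ x \in X, y \in Y & z = x + M * y]) (z \in pack M X Y).
Proof.
apply: (iffP (imfset2P _ _ _ _ _)) => [[x xX [y yY ->]]|[x [y [xX yY ->]]]].
  by exists x, y.
by exists x => //; exists y.
Qed.

(** Two values of [x] differ by at most [2 * N < M], so [x + M * y] determines [y] and then [x]. *)
Lemma card_pack (N M : int) X Y : 2 * N < M -> (forall x, x \in X -> `|x| <= N) ->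
  #|` pack M X Y| = (#|` X| * #|` Y|)%N.
Proof.
move=> NM XN; pose s := [seq x + M * y | x <- X, y <- Y].
have /card_fset_seq -> : pack M X Y =i s.
  move=> z; apply/packP/allpairsP => [[x [y [? ? ->]]]|[[x y] [? ? ->]]].
    by exists (x, y).
  by exists x, y.
rewrite undup_id ?size_allpairs //; apply: allpairs_uniq; rewrite ?fset_uniq //.
move=> _ _ /allpairsP[[x y] [/= xX yY ->]] /allpairsP[[x' y'] [/= xX' yY' ->]] /= eq_xy.
have /XN xN := xX; have /XN xN' := xX'.
case: (ltgtP y y') => [lt_y|gt_y|yE]; [exfalso; nia|exfalso; nia|].
by rewrite -yE in eq_xy *; congr (_, _); lia.
Qed.

(** Packing commutes with taking sums and differences. These are at most [2 * N] in absolute value,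
    and [M = 4 * N + 1] exceeds twice that bound. *)
Lemma card_square A : exists B, [/\ #|` B| = (#|` A| ^ 2)%N,
  #|` sumset B| = (#|` sumset A| ^ 2)%N & #|` diffset B| = (#|` diffset A| ^ 2)%N].
Proof.
pose n := (\max_(x <- A) absz x)%N; pose N : int := n%:Z; pose M := 4 * N + 1.
have AN x : x \in A -> `|x| <= N.
  move=> xA; have : (absz x <= n)%N by apply: leq_bigmax_seq.
  by rewrite /N; lia.
have sumE : sumset (pack M A A) = pack M (sumset A) (sumset A).
  apply/fsetP => z; apply/sumsetP/packP.
    move=> [_ [_ [/packP[x [y [xA yA ->]]] /packP[x' [y' [xA' yA' ->]]] ->]]].
    exists (x + x'), (y + y'); split; [| |by lia].
      by apply/sumsetP; exists x, x'.
    by apply/sumsetP; exists y, y'.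
  move=> [_ [_ [/sumsetP[x [x' [xA xA' ->]]] /sumsetP[y [y' [yA yA' ->]]] ->]]].
  exists (x + M * y), (x' + M * y'); split; [| |by lia].
    by apply/packP; exists x, y.
  by apply/packP; exists x', y'.
have diffE : diffset (pack M A A) = pack M (diffset A) (diffset A).
  apply/fsetP => z; apply/diffsetP/packP.
    move=> [_ [_ [/packP[x [y [xA yA ->]]] /packP[x' [y' [xA' yA' ->]]] ->]]].
    exists (x - x'), (y - y'); split; [| |by lia].
      by apply/diffsetP; exists x, x'.
    by apply/diffsetP; exists y, y'.
  move=> [_ [_ [/diffsetP[x [x' [xA xA' ->]]] /diffsetP[y [y' [yA yA' ->]]] ->]]].
  exists (x + M * y), (x' + M * y'); split; [| |by lia].
    by apply/packP; exists x, y.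
  by apply/packP; exists x', y'.
exists (pack M A A); rewrite sumE diffE -!mulnn.
split; rewrite (card_pack (N := 2 * N)) //; try by rewrite /M; lia.
- by move=> x /AN; lia.
- by move=> _ /sumsetP[x [y [/AN xA /AN yA ->]]]; lia.
- by move=> _ /diffsetP[x [y [/AN xA /AN yA ->]]]; lia.
Qed.

Lemma sum_surplus_max_exists : exists t, sum_surplus_max t.
Proof.
(* Conway's MSTD set; squaring it twice gives the fourth power. *)
pose s : seq int := [:: 0; 2; 3; 4; 7; 11; 12; 14].
pose A0 : {fset int} := [fset x in s].
have As : A0 =i s by move=> x; rewrite in_fset.
have [A1 [c1 s1 d1]] := card_square A0; have [A2 [c2 s2 d2]] := card_square A1.
have c0 : #|` A0| = 8 by rewrite (card_fset_seq As).
have s0 : #|` sumset A0| = 26 by rewrite (card_sumset_seq As); vm_compute.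
have d0 : #|` diffset A0| = 25 by rewrite (card_diffset_seq As); vm_compute.
pose n := (\max_(x <- A2) absz x)%N.
have A2n x : x \in A2 -> (absz x <= n)%N by move=> xA; apply: leq_bigmax_seq.
(* The elements of [A2] lie between [- n] and [n], so those of [A] lie between [1] and
   [2 * n + 1]. *)
pose A := translate (n%:Z + 1) A2.
have Apos a : a \in A -> 0 < a by rewrite mem_translate => /A2n; lia.
have A_neq0 : A != fset0.
  by rewrite -cardfs_gt0 card_translate c2 c1 c0.
have [a0 a0A] : exists a, a \in A by have /fset0Pn[a] := A_neq0; exists a.
have exA : exists t, (t%:Z \in A) by exists (absz a0); rewrite gez0_abs // ltW ?Apos.
have bndA t : t%:Z \in A -> (t <= 2 * n + 1)%N.
  by rewrite mem_translate => /A2n; lia.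
case: (ex_maxnP exA bndA) => t tA tmax.
exists t, A; split=> //.
  rewrite sumset_translate diffset_translate !card_translate c2 s2 d2 c1 s1 d1 c0 s0 d0.
  by lia.
split=> // a aA; have a_pos := Apos a aA.
have := tmax (absz a); rewrite gez0_abs ?(ltW a_pos) // => /(_ aA); lia.
Qed.

(** A set of [n] positive integers with maximum [t] has [n <= t], and the surplus condition forces
    [10 * n <= n ^ 2]. *)
Lemma sum_surplus_max_ge10 t : sum_surplus_max t -> (10 <= t)%N.
Proof.
move=> [A [A0 Apos surplus [_ tmax]]].
have c0 : (0 < #|` A|)%N by rewrite cardfs_gt0.
have At : (#|` A| <= t)%N.
  rewrite -(card_initial_interval t); apply/fsubset_leq_card/fsubsetP => x xA.
  by rewrite mem_initial_interval; have := Apos x xA; have := tmax x xA; lia.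
have sums_le : (#|` sumset A| <= #|` A| * #|` A|)%N.
  rewrite (card_sumset_seq (fun _ => erefl)).
  by apply: leq_trans (size_undup _) _; rewrite size_allpairs.
nia.
Qed.

(** [P] need not be decidable, so the descent to a smaller witness uses excluded middle. *)
Lemma ex_is_least (P : nat -> Prop) n : P n -> exists m, is_least P m.
Proof.
elim/ltn_ind: n => n IHn Pn.
have [[m [mn Pm]]|no] := classic (exists m, (m < n)%N /\ P m); first exact: IHn Pm.
exists n; split=> // m Pm; rewrite leqNgt; apply/negP => mn.
by apply: no; exists m.
Qed.

End Existence.

Theorem theorem1p4 (k : nat) (hk : (2 <= k)%N) :
  exists R : nat,
    is_least (fun n => (0 < n)%N /\
                forall r : nat, (n <= r)%N ->
                  MSTD_decomposable k (initial_interval r)) R /\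
    ~ MSTD_decomposable k (initial_interval (R - 1)) /\
    (~~ odd k -> (8 * k <= R)%N /\ (R <= 10 * k)%N) /\
    ((5 <= k)%N -> odd k -> (8 * k <= R)%N /\ (R <= 20 * k - 14)%N) /\
    (k = 3 -> exists T : nat,
                is_least sum_surplus_max T /\
                (24 <= R)%N /\ (R <= 4 * T + 24)%N).
Proof.
pose good n := (0 < n)%N /\
  forall r : nat, (n <= r)%N -> MSTD_decomposable k (initial_interval r).
have even_good : ~~ odd k -> good (10 * k)%N.
  move=> even_k; split=> [|r kr]; first by lia.
  (* With [j = k./2 - 1] blocks added to length 20, the bound is [20 + 20 * j = 10 * k]. *)
  have -> : k = (2 + 2 * (k./2).-1)%N by lia.
  by apply: (decomposable_blocks decomposable2); lia.
have odd_good : odd k -> good (46 + 10 * (k - 3))%N.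
  move=> odd_k; split=> [|r kr]; first by lia.
  have -> : k = (3 + 2 * (k - 3)./2)%N by lia.
  by apply: (decomposable_blocks decomposable3); lia.
have [R [Rgood Rleast]] : exists R, is_least good R.
  by have [/odd_good|/even_good] := boolP (odd k); apply: ex_is_least.
have R_ge : (8 * k <= R)%N.
  have := MSTD_decomposable_card (Rgood.2 R (leqnn R)).
  by rewrite card_initial_interval.
exists R; split; first by split.
(* A decomposition at [R - 1] would make [R - 1] good, against minimality; [R - 1] is positive
   because [R >= 8 * k]. *)
split=> [dec|].
  suff /Rleast : good (R - 1)%N by lia.
  split=> [|r Rr]; first by lia.
  have [->|rR] := eqVneq r (R - 1)%N; first exact: dec.
  by apply: Rgood.2; lia.
(* For odd [k] the bound is [46 + 10 * (k - 3) = 10 * k + 16], which is at most [20 * k - 14] once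
   [k >= 3]. *)
split=> [/even_good/Rleast //|]; split=> [k5 /odd_good/Rleast|k3]; first by split=> //; lia.
have [t0 /ex_is_least[T Tleast]] := sum_surplus_max_exists.
exists T; split=> //; have T10 := sum_surplus_max_ge10 Tleast.1.
by have := Rleast _ (odd_good _); rewrite k3 => /(_ isT); lia.
Qed.
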